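(* The sequence spaces $cs^{\lambda}$, $cs_0^{\lambda}$ and $bs^{\lambda}$ are isometrically isomorphic to the spaces $cs$, $cs_0$ and $bs$, respectively; that is, $cs^{\lambda}\cong cs$, $cs_0^{\lambda}\cong cs_0$ and $bs^{\lambda}\cong bs$.
   Context: $\mathbb{N}=\{0,1,2,\dots\}$ and $w=\mathbb{C}^{\mathbb{N}}$ is the space of all complex sequences. $\lambda=(\lambda_k)_{k\in\mathbb{N}}$ is a fixed strictly increasing sequence of positive reals tending to infinity, with the convention $\lambda_{-1}=0$. For $x=(x_k)\in w$ put $\Lambda(x)=(\Lambda_n(x))_{n\in\mathbb{N}}$, $\Lambda_n(x)=\frac{1}{\lambda_n}\sum_{k=0}^{n}(\lambda_k-\lambda_{k-1})x_k$. $cs$, $cs_0$, $bs$ are the spaces of sequences $x\in w$ whose sequence of partial sums $\left(\sum_{n=0}^m x_n\right)_m$ is, respectively, convergent, convergent to $0$, bounded; each is normed by $\sup_m\left|\sum_{n=0}^m x_n\right|$. Define $cs^{\lambda}=\{x\in w:\Lambda(x)\in cs\}$, $cs_0^{\lambda}=\{x\in w:\Lambda(x)\in cs_0\}$, $bs^{\lambda}=\{x\in w:\Lambda(x)\in bs\}$, each normed by $\|x\|=\sup_m\left|\sum_{n=0}^m\Lambda_n(x)\right|$. (The paper calls these spaces ''of non-absolute type'', meaning that in general the norm of $x$ differs from the norm of $|x|=(|x_k|)$ for at least one sequence.) *)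

(* Defs.v *)
From HB Require Import structures.
From mathcomp Require Import all_boot all_order all_algebra.
From mathcomp Require Import all_classical all_reals all_analysis.
From mathcomp Require Import complex.

Set Implicit Arguments.
Unset Strict Implicit.
Unset Printing Implicit Defensive.

Import Order.TTheory GRing.Theory Num.Theory.
Import numFieldNormedType.Exports.
Import Normc.

Local Open Scope classical_set_scope.
Local Open Scope ring_scope.
Local Open Scope complex_scope.

Record lambda_seq (R : realType) := LambdaSeq {
  lambda_val :> nat -> R;
  lambda_gt0 : forall k, 0 < lambda_val k;
  lambda_incr : forall m n, (m < n)%N -> lambda_val m < lambda_val n;
  lambda_cvgy : lambda_val @ \oo --> +oo }.

Definition isometrically_isomorphic (K : numFieldType)
    (U V : normedModType K) : Prop :=
  exists f : {linear U -> V}, bijective f /\ forall x : U, `|f x| = `|x|.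

Section PartialSums.
Variable K : numFieldType.
Implicit Types (a : K) (x y : nat -> K).

Definition psum x : nat -> K := fun m => \sum_(n < m.+1) x n.

Definition cs_pred : {pred nat -> K} := [pred x | `[< cvgn (psum x) >]].
Definition cs0_pred : {pred nat -> K} :=
  [pred x | `[< psum x @ \oo --> (0 : K) >]].
Definition bs_pred : {pred nat -> K} := [pred x | `[< bounded_fun (psum x) >]].

Lemma psumD x y : psum (x + y) = psum x + psum y.
Proof. by apply/funext => m; rewrite /psum big_split. Qed.

Lemma psumZ a x : psum (a *: x) = a *: psum x.
Proof. by apply/funext => m; rewrite -[RHS]/(a * _) mulr_sumr. Qed.

Lemma psum0 : psum 0 = 0.
Proof. by apply/funext => m; rewrite /psum big1. Qed.

Lemma psum_eq0 x : psum x = 0 -> x = 0.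
Proof.
move=> x0; apply/funext => -[|n].
  by move/(congr1 (@^~ 0%N)): x0; rewrite /psum big_ord1.
have : psum x n.+1 = psum x n + x n.+1 by rewrite /psum big_ord_recr.
by rewrite x0 add0r => <-.
Qed.

Lemma cs_predP x : reflect (cvgn (psum x)) (x \in cs_pred).
Proof. exact: asboolP. Qed.

Lemma cs0_predP x : reflect (psum x @ \oo --> (0 : K)) (x \in cs0_pred).
Proof. exact: asboolP. Qed.

Fact cs_submod_closed : submod_closed cs_pred.
Proof.
split=> [|a x y].
  by apply/cs_predP; rewrite psum0; exact: (is_cvg_cst (0 : K)).
move=> /cs_predP cx /cs_predP cy; apply/cs_predP; rewrite psumD psumZ.
by apply: is_cvgD => //; exact: is_cvgZl_tmp.
Qed.

Fact cs0_submod_closed : submod_closed cs0_pred.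
Proof.
split=> [|a x y].
  by apply/cs0_predP; rewrite psum0; exact: (cvg_cst (0 : K)).
move=> /cs0_predP cx /cs0_predP cy; apply/cs0_predP; rewrite psumD psumZ.
rewrite -[X in _ --> X](addr0 (0 : K)); apply: cvgD => //.
by rewrite -(scaler0 K a); exact: cvgZl_tmp.
Qed.

Lemma bs_predP x : reflect (exists2 M : K, M \is Num.real &
  forall m, `|psum x m| <= M) (x \in bs_pred).
Proof.
apply: (iffP (asboolP (bounded_fun (psum x)))) => [[M [Mreal xM]]|[M Mreal xM]].
  exists (M + 1); first by rewrite realD.
  by move=> m; apply: (xM (M + 1)) => //; rewrite ltrDl.
by exists M; split=> // e Me m _ /=; exact: le_trans (ltW Me).
Qed.

Fact bs_submod_closed : submod_closed bs_pred.
Proof.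
split=> [|a x y].
  by apply/bs_predP; exists 0 => // m; rewrite psum0 normr0.
move=> /bs_predP[M Mreal xM] /bs_predP[N Nreal yN]; apply/bs_predP.
exists (`|a| * M + N) => [|m]; first by rewrite realD// realM.
rewrite psumD psumZ (le_trans (ler_normD _ _))// lerD// normrM.
by rewrite ler_wpM2l.
Qed.

Lemma cs_bs x : x \in cs_pred -> x \in bs_pred.
Proof. by move=> /cs_predP cx; apply/asboolP; exact: cvg_seq_bounded. Qed.

Lemma cs0_cs x : x \in cs0_pred -> x \in cs_pred.
Proof. by move=> /cs0_predP cx; apply/cs_predP/cvg_ex; exists 0. Qed.

End PartialSums.

Section SupNorm.
Variable R : realType.
Implicit Types (a : R[i]) (x y : nat -> R[i]).

(* [normc] is the complex modulus with values in [R]. *)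
Definition sup_psum x : R := sup (range (fun m => normc (psum x m))).

Lemma normc_ge0 a : 0 <= normc a.
Proof. by case: a => ? ?; exact: sqrtr_ge0. Qed.

Lemma sup_psum_ub x : x \in @bs_pred R[i] ->
  forall m, normc (psum x m) <= sup_psum x.
Proof.
move=> /bs_predP[_ /complex_realP[M ->] xM] m.
apply: ub_le_sup; last by exists m.
by exists M => _ [k _ <-]; have := xM k; rewrite lecR.
Qed.

Lemma sup_psum_le x (M : R) :
  (forall m, normc (psum x m) <= M) -> sup_psum x <= M.
Proof.
move=> xM; apply: ge_sup; first by exists (normc (psum x 0%N)), 0%N.
by move=> _ [k _ <-].
Qed.

Lemma sup_psum_ge0 x : x \in @bs_pred R[i] -> 0 <= sup_psum x.
Proof. by move=> /sup_psum_ub/(_ 0%N); apply: le_trans; exact: normc_ge0. Qed.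

Lemma sup_psumD x y : x \in @bs_pred R[i] -> y \in @bs_pred R[i] ->
  (sup_psum (x + y))%:C <= (sup_psum x)%:C + (sup_psum y)%:C.
Proof.
move=> bx by_; rewrite -rmorphD lecR; apply: sup_psum_le => m.
rewrite psumD (le_trans (le_normcD _ _))//.
exact: lerD (sup_psum_ub bx m) (sup_psum_ub by_ m).
Qed.

Lemma sup_psumZ a x : x \in @bs_pred R[i] ->
  (sup_psum (a *: x))%:C = `|a| * (sup_psum x)%:C.
Proof.
have [b0 bD] := bs_submod_closed R[i].
move=> bx; rewrite -[`|a|]/((normc a)%:C) -rmorphM; congr (_%:C).
have le b y : y \in @bs_pred R[i] -> sup_psum (b *: y) <= normc b * sup_psum y.
  move=> h; apply: sup_psum_le => m.
  by rewrite psumZ normcM ler_wpM2l ?normc_ge0 ?sup_psum_ub.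
apply/eqP; rewrite eq_le le//=.
have [->|a0] := eqVneq a 0.
  by rewrite normc0 mul0r scale0r; exact: sup_psum_ge0 b0.
have bax : a *: x \in @bs_pred R[i].
  by have := bD a x 0 bx b0; rewrite addr0.
have na0 : 0 < normc a.
  by rewrite lt_def normc_ge0 andbT; apply: contra a0 => /eqP/eq0_normc ->.
rewrite -ler_pdivlMl// -normcV.
by apply: le_trans (le _ _ bax); rewrite scalerA mulVf// scale1r.
Qed.

Lemma sup_psum_eq0 x : x \in @bs_pred R[i] -> (sup_psum x)%:C = 0 -> x = 0.
Proof.
move=> bx /complexI x0; apply: psum_eq0; apply/funext => m; apply: eq0_normc.
by apply/eqP; rewrite eq_le normc_ge0 andbT -x0 sup_psum_ub.
Qed.

End SupNorm.

Section LambdaMeans.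
Variables (R : realType) (lam : lambda_seq R).
Implicit Types (a : R[i]) (x y : nat -> R[i]).

(* [lambda_prev k] is lambda_(k-1), with the convention lambda_(-1) = 0. *)
Definition lambda_prev (k : nat) : R := if k is k'.+1 then lam k' else 0.

Definition Lambda x : nat -> R[i] := fun n =>
  (lam n)^-1%:C * \sum_(k < n.+1) (lam k - lambda_prev k)%:C * x k.

Definition csl_pred : {pred nat -> R[i]} :=
  [pred x | Lambda x \in @cs_pred R[i]].
Definition cs0l_pred : {pred nat -> R[i]} :=
  [pred x | Lambda x \in @cs0_pred R[i]].
Definition bsl_pred : {pred nat -> R[i]} :=
  [pred x | Lambda x \in @bs_pred R[i]].

Lemma LambdaD x y : Lambda (x + y) = Lambda x + Lambda y.
Proof.
apply/funext => n; rewrite -[RHS]/(Lambda x n + Lambda y n).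
rewrite /Lambda -mulrDr -big_split/=.
by congr (_ * _); apply: eq_bigr => k _; rewrite -mulrDr.
Qed.

Lemma LambdaZ a x : Lambda (a *: x) = a *: Lambda x.
Proof.
apply/funext => n; rewrite -[RHS]/(a * Lambda x n) /Lambda [RHS]mulrCA.
by congr (_ * _); rewrite mulr_sumr; apply: eq_bigr => k _; rewrite mulrCA.
Qed.

Lemma Lambda0 : Lambda 0 = 0.
Proof.
by apply/funext => n; rewrite /Lambda big1 ?mulr0// => k _; rewrite mulr0.
Qed.

Lemma lambda_prev_lt k : lambda_prev k < lam k.
Proof. by case: k => [|k]; [exact: lambda_gt0|exact: lambda_incr]. Qed.

Lemma Lambda_eq0 x : Lambda x = 0 -> x = 0.
Proof.
move=> x0; pose z k := (lam k - lambda_prev k)%:C * x k.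
have : z = 0.
  apply: psum_eq0; apply/funext => m.
  have /eqP := congr1 (@^~ m) x0; rewrite /Lambda /= mulf_eq0 => /orP[|/eqP//].
  by rewrite -(rmorph0 (real_complex R)) (inj_eq (@complexI R))
    invr_eq0 gt_eqF ?lambda_gt0.
move=> z0; apply/funext => k; have /eqP := congr1 (@^~ k) z0.
rewrite /z mulf_eq0 => /orP[|/eqP//].
by rewrite -(rmorph0 (real_complex R)) (inj_eq (@complexI R))
    subr_eq0 gt_eqF ?lambda_prev_lt.
Qed.

Lemma Lambda_submod_closed (P : {pred nat -> R[i]}) :
  submod_closed P -> submod_closed [pred x | Lambda x \in P].
Proof.
move=> [P0 PD]; split => [|a x y]; rewrite !inE ?Lambda0//.
by rewrite LambdaD LambdaZ; exact: PD.
Qed.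

Fact csl_submod_closed : submod_closed csl_pred.
Proof. exact: Lambda_submod_closed (@cs_submod_closed _). Qed.

Fact cs0l_submod_closed : submod_closed cs0l_pred.
Proof. exact: Lambda_submod_closed (@cs0_submod_closed _). Qed.

Fact bsl_submod_closed : submod_closed bsl_pred.
Proof. exact: Lambda_submod_closed (@bs_submod_closed _). Qed.

Lemma csl_bs x : x \in csl_pred -> Lambda x \in @bs_pred R[i].
Proof. by rewrite unfold_in /= => /cs_bs. Qed.

Lemma cs0l_bs x : x \in cs0l_pred -> Lambda x \in @bs_pred R[i].
Proof. by rewrite unfold_in /= => /cs0_cs/cs_bs. Qed.

Lemma bsl_bs x : x \in bsl_pred -> Lambda x \in @bs_pred R[i].
Proof. by rewrite unfold_in. Qed.

Definition lambda_norm x : R[i] := (sup_psum (Lambda x))%:C.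

Lemma lambda_normD x y :
  Lambda x \in @bs_pred R[i] -> Lambda y \in @bs_pred R[i] ->
  lambda_norm (x + y) <= lambda_norm x + lambda_norm y.
Proof. by rewrite /lambda_norm LambdaD; exact: sup_psumD. Qed.

Lemma lambda_normZ a x : Lambda x \in @bs_pred R[i] ->
  lambda_norm (a *: x) = `|a| * lambda_norm x.
Proof. by rewrite /lambda_norm LambdaZ; exact: sup_psumZ. Qed.

Lemma lambda_norm_eq0 x :
  Lambda x \in @bs_pred R[i] -> lambda_norm x = 0 -> x = 0.
Proof. by move=> bx /(sup_psum_eq0 bx)/Lambda_eq0. Qed.

End LambdaMeans.

(* The suffix [l] in [csl], [cs0l] and [bsl] stands for the superscript lambda. *)

HB.instance Definition _ (R : realType) :=
  GRing.isSubmodClosed.Build R[i] (nat -> R[i]) (@cs_pred R[i])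
    (@cs_submod_closed R[i]).

Record cs (R : realType) := CS {
  cs_val :> nat -> R[i];
  _ : cs_val \in @cs_pred R[i] }.

HB.instance Definition _ (R : realType) := [isSub for @cs_val R].
HB.instance Definition _ (R : realType) := [Choice of cs R by <:].
HB.instance Definition _ (R : realType) :=
  [SubChoice_isSubLmodule of cs R by <:].

Section Norm_cs.
Variable R : realType.
Implicit Types x y : cs R.

Definition cs_norm x : R[i] := (sup_psum x)%:C.

Fact cs_normD x y : cs_norm (x + y) <= cs_norm x + cs_norm y.
Proof. exact: sup_psumD (cs_bs (valP x)) (cs_bs (valP y)). Qed.

Fact cs_normZ (a : R[i]) x : cs_norm (a *: x) = `|a| * cs_norm x.
Proof. exact: sup_psumZ (cs_bs (valP x)). Qed.

Fact cs_norm_eq0 x : cs_norm x = 0 -> x = 0.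
Proof. by move=> /(sup_psum_eq0 (cs_bs (valP x))) x0; exact: val_inj. Qed.

End Norm_cs.

HB.instance Definition _ (R : realType) :=
  Lmodule_isNormed.Build R[i] (cs R) (@cs_normD R) (@cs_normZ R)
    (@cs_norm_eq0 R).

HB.instance Definition _ (R : realType) :=
  GRing.isSubmodClosed.Build R[i] (nat -> R[i]) (@cs0_pred R[i])
    (@cs0_submod_closed R[i]).

Record cs0 (R : realType) := CS0 {
  cs0_val :> nat -> R[i];
  _ : cs0_val \in @cs0_pred R[i] }.

HB.instance Definition _ (R : realType) := [isSub for @cs0_val R].
HB.instance Definition _ (R : realType) := [Choice of cs0 R by <:].
HB.instance Definition _ (R : realType) :=
  [SubChoice_isSubLmodule of cs0 R by <:].

Section Norm_cs0.
Variable R : realType.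
Implicit Types x y : cs0 R.

Definition cs0_norm x : R[i] := (sup_psum x)%:C.

Fact cs0_normD x y : cs0_norm (x + y) <= cs0_norm x + cs0_norm y.
Proof.
exact: sup_psumD (cs_bs (cs0_cs (valP x))) (cs_bs (cs0_cs (valP y))).
Qed.

Fact cs0_normZ (a : R[i]) x : cs0_norm (a *: x) = `|a| * cs0_norm x.
Proof. exact: sup_psumZ (cs_bs (cs0_cs (valP x))). Qed.

Fact cs0_norm_eq0 x : cs0_norm x = 0 -> x = 0.
Proof.
by move=> /(sup_psum_eq0 (cs_bs (cs0_cs (valP x)))) x0; exact: val_inj.
Qed.

End Norm_cs0.

HB.instance Definition _ (R : realType) :=
  Lmodule_isNormed.Build R[i] (cs0 R) (@cs0_normD R) (@cs0_normZ R)
    (@cs0_norm_eq0 R).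

HB.instance Definition _ (R : realType) :=
  GRing.isSubmodClosed.Build R[i] (nat -> R[i]) (@bs_pred R[i])
    (@bs_submod_closed R[i]).

Record bs (R : realType) := BS {
  bs_val :> nat -> R[i];
  _ : bs_val \in @bs_pred R[i] }.

HB.instance Definition _ (R : realType) := [isSub for @bs_val R].
HB.instance Definition _ (R : realType) := [Choice of bs R by <:].
HB.instance Definition _ (R : realType) :=
  [SubChoice_isSubLmodule of bs R by <:].

Section Norm_bs.
Variable R : realType.
Implicit Types x y : bs R.

Definition bs_norm x : R[i] := (sup_psum x)%:C.

Fact bs_normD x y : bs_norm (x + y) <= bs_norm x + bs_norm y.
Proof. exact: sup_psumD (valP x) (valP y). Qed.

Fact bs_normZ (a : R[i]) x : bs_norm (a *: x) = `|a| * bs_norm x.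
Proof. exact: sup_psumZ (valP x). Qed.

Fact bs_norm_eq0 x : bs_norm x = 0 -> x = 0.
Proof. by move=> /(sup_psum_eq0 (valP x)) x0; exact: val_inj. Qed.

End Norm_bs.

HB.instance Definition _ (R : realType) :=
  Lmodule_isNormed.Build R[i] (bs R) (@bs_normD R) (@bs_normZ R)
    (@bs_norm_eq0 R).

HB.instance Definition _ (R : realType) (lam : lambda_seq R) :=
  GRing.isSubmodClosed.Build R[i] (nat -> R[i]) (csl_pred lam)
    (csl_submod_closed lam).

Record csl (R : realType) (lam : lambda_seq R) := CSL {
  csl_val :> nat -> R[i];
  _ : csl_val \in csl_pred lam }.

HB.instance Definition _ (R : realType) (lam : lambda_seq R) :=
  [isSub for @csl_val R lam].
HB.instance Definition _ (R : realType) (lam : lambda_seq R) :=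
  [Choice of csl lam by <:].
HB.instance Definition _ (R : realType) (lam : lambda_seq R) :=
  [SubChoice_isSubLmodule of csl lam by <:].

Section Norm_csl.
Variables (R : realType) (lam : lambda_seq R).
Implicit Types x y : csl lam.

Definition csl_norm x : R[i] := (sup_psum (Lambda lam x))%:C.

Fact csl_normD x y : csl_norm (x + y) <= csl_norm x + csl_norm y.
Proof.
exact: (@lambda_normD R lam x y (csl_bs (valP x)) (csl_bs (valP y))).
Qed.

Fact csl_normZ (a : R[i]) x : csl_norm (a *: x) = `|a| * csl_norm x.
Proof. exact: (@lambda_normZ R lam a x (csl_bs (valP x))). Qed.

Fact csl_norm_eq0 x : csl_norm x = 0 -> x = 0.
Proof. by move=> /(lambda_norm_eq0 (csl_bs (valP x))) x0; exact: val_inj. Qed.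

End Norm_csl.

HB.instance Definition _ (R : realType) (lam : lambda_seq R) :=
  Lmodule_isNormed.Build R[i] (csl lam) (@csl_normD R lam) (@csl_normZ R lam)
    (@csl_norm_eq0 R lam).

HB.instance Definition _ (R : realType) (lam : lambda_seq R) :=
  GRing.isSubmodClosed.Build R[i] (nat -> R[i]) (cs0l_pred lam)
    (cs0l_submod_closed lam).

Record cs0l (R : realType) (lam : lambda_seq R) := CS0L {
  cs0l_val :> nat -> R[i];
  _ : cs0l_val \in cs0l_pred lam }.

HB.instance Definition _ (R : realType) (lam : lambda_seq R) :=
  [isSub for @cs0l_val R lam].
HB.instance Definition _ (R : realType) (lam : lambda_seq R) :=
  [Choice of cs0l lam by <:].
HB.instance Definition _ (R : realType) (lam : lambda_seq R) :=
  [SubChoice_isSubLmodule of cs0l lam by <:].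

Section Norm_cs0l.
Variables (R : realType) (lam : lambda_seq R).
Implicit Types x y : cs0l lam.

Definition cs0l_norm x : R[i] := (sup_psum (Lambda lam x))%:C.

Fact cs0l_normD x y : cs0l_norm (x + y) <= cs0l_norm x + cs0l_norm y.
Proof.
exact: (@lambda_normD R lam x y (cs0l_bs (valP x)) (cs0l_bs (valP y))).
Qed.

Fact cs0l_normZ (a : R[i]) x : cs0l_norm (a *: x) = `|a| * cs0l_norm x.
Proof. exact: (@lambda_normZ R lam a x (cs0l_bs (valP x))). Qed.

Fact cs0l_norm_eq0 x : cs0l_norm x = 0 -> x = 0.
Proof. by move=> /(lambda_norm_eq0 (cs0l_bs (valP x))) x0; exact: val_inj. Qed.

End Norm_cs0l.

HB.instance Definition _ (R : realType) (lam : lambda_seq R) :=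
  Lmodule_isNormed.Build R[i] (cs0l lam) (@cs0l_normD R lam) (@cs0l_normZ R lam)
    (@cs0l_norm_eq0 R lam).

HB.instance Definition _ (R : realType) (lam : lambda_seq R) :=
  GRing.isSubmodClosed.Build R[i] (nat -> R[i]) (bsl_pred lam)
    (bsl_submod_closed lam).

Record bsl (R : realType) (lam : lambda_seq R) := BSL {
  bsl_val :> nat -> R[i];
  _ : bsl_val \in bsl_pred lam }.

HB.instance Definition _ (R : realType) (lam : lambda_seq R) :=
  [isSub for @bsl_val R lam].
HB.instance Definition _ (R : realType) (lam : lambda_seq R) :=
  [Choice of bsl lam by <:].
HB.instance Definition _ (R : realType) (lam : lambda_seq R) :=
  [SubChoice_isSubLmodule of bsl lam by <:].

Section Norm_bsl.
Variables (R : realType) (lam : lambda_seq R).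
Implicit Types x y : bsl lam.

Definition bsl_norm x : R[i] := (sup_psum (Lambda lam x))%:C.

Fact bsl_normD x y : bsl_norm (x + y) <= bsl_norm x + bsl_norm y.
Proof.
exact: (@lambda_normD R lam x y (bsl_bs (valP x)) (bsl_bs (valP y))).
Qed.

Fact bsl_normZ (a : R[i]) x : bsl_norm (a *: x) = `|a| * bsl_norm x.
Proof. exact: (@lambda_normZ R lam a x (bsl_bs (valP x))). Qed.

Fact bsl_norm_eq0 x : bsl_norm x = 0 -> x = 0.
Proof. by move=> /(lambda_norm_eq0 (bsl_bs (valP x))) x0; exact: val_inj. Qed.

End Norm_bsl.

HB.instance Definition _ (R : realType) (lam : lambda_seq R) :=
  Lmodule_isNormed.Build R[i] (bsl lam) (@bsl_normD R lam) (@bsl_normZ R lam)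
    (@bsl_norm_eq0 R lam).

(* Main.v *)
(** The map [x |-> Lambda x] is a linear bijection of the space of all sequences:
    [lambda_n Lambda_n(x)] is the partial sum of [(lambda_k - lambda_(k-1)) x_k],
    so [x] is recovered from [y = Lambda x] by differencing,
    [x_k = (lambda_k y_k - lambda_(k-1) y_(k-1)) / (lambda_k - lambda_(k-1))].
    Each lambda-space is the preimage under [Lambda] of the corresponding classical
    space and carries the norm pulled back along [Lambda], so [Lambda] restricts to
    a surjective linear isometry. *)
Require Import Defs.
From HB Require Import structures.
From mathcomp Require Import all_boot all_order all_algebra.
From mathcomp Require Import all_classical all_reals all_analysis.
From mathcomp Require Import complex.

Import Order.TTheory GRing.Theory Num.Theory.
Local Open Scope ring_scope.
Local Open Scope complex_scope.

Section LambdaInverse.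
Context {R : realType} (lam : lambda_seq R).
Implicit Types y : nat -> R[i].

(** At [k = 0] the truncated [k.-1] gives [y 0], harmless because its coefficient
    [lambda_prev lam 0] is 0. *)
Definition Lambda_inv y : nat -> R[i] := fun k =>
  ((lam k - lambda_prev lam k)^-1)%:C *
  ((lam k)%:C * y k - (lambda_prev lam k)%:C * y k.-1).

Lemma Lambda_invK y : Lambda lam (Lambda_inv y) = y.
Proof.
apply/funext => n; rewrite /Lambda.
have -> : \sum_(k < n.+1) (lam k - lambda_prev lam k)%:C * Lambda_inv y k
    = (lam n)%:C * y n.
  have cancel k : (lam k - lambda_prev lam k)%:C * Lambda_inv y k
      = (lam k)%:C * y k - (lambda_prev lam k)%:C * y k.-1.
    rewrite mulrA -rmorphM mulfV ?rmorph1 ?mul1r//.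
    by rewrite subr_eq0 gt_eqF ?lambda_prev_lt.
  elim: n => [|n IHn]; first by rewrite big_ord1 cancel/= rmorph0 mul0r subr0.
  by rewrite big_ord_recr/= IHn cancel/= addrC subrK.
by rewrite mulrA -rmorphM mulVf ?gt_eqF ?lambda_gt0// rmorph1 mul1r.
Qed.

End LambdaInverse.

(* [u] and [v] realise [U] and [V] as spaces of sequences. *)
Lemma Lambda_isometry {R : realType} (lam : lambda_seq R)
    (U V : normedModType R[i])
    (u : {linear U -> (nat -> R[i])}) (v : {linear V -> (nat -> R[i])})
    (f : U -> V) (g : V -> U) :
  injective v ->
  (forall x, `|x| = (sup_psum (Lambda lam (u x)))%:C) ->
  (forall y, `|y| = (sup_psum (v y))%:C) ->
  (forall x, v (f x) = Lambda lam (u x)) ->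
  (forall y, u (g y) = Lambda_inv lam (v y)) ->
  isometrically_isomorphic U V.
Proof.
move=> v_inj normU normV vf ug.
have f_lin : linear f.
  move=> a x y; apply: v_inj.
  by rewrite vf linearP LambdaD LambdaZ -!vf linearP.
pose flin := GRing.isLinear.Build _ _ _ _ f f_lin.
pose F : {linear U -> V} := HB.pack f flin.
have F_iso x : `|F x| = `|x| by rewrite normV normU vf.
exists F; split=> //; exists g => [x|y]; last first.
  by apply: v_inj; rewrite vf ug Lambda_invK.
(* A linear isometry is injective, so [g (F x) = x] can be checked after applying [F], where [g] is
   a right inverse. *)
apply/eqP; rewrite -subr_eq0 -normr_eq0 -F_iso linearB normr_eq0 subr_eq0.
by apply/eqP; apply: v_inj; rewrite vf ug Lambda_invK.
Qed.

Theorem theorem2p2 (R : realType) (lam : lambda_seq R) :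
  isometrically_isomorphic (csl lam) (cs R) /\
  isometrically_isomorphic (cs0l lam) (cs0 R) /\
  isometrically_isomorphic (bsl lam) (bs R).
Proof.
have memL (P : {pred nat -> R[i]}) x :
    x \in [pred x | Lambda lam x \in P] -> Lambda lam x \in P by rewrite inE.
(* Membership in the preimage of [P] only asks that [Lambda lam (Lambda_inv lam y)], which is [y],
   lie in [P]. *)
have memLinv (P : {pred nat -> R[i]}) y :
    y \in P -> Lambda_inv lam y \in [pred x | Lambda lam x \in P].
  by rewrite inE Lambda_invK.
split; [|split].
- apply: (@Lambda_isometry R lam (csl lam) (cs R) \val \val
    (fun x => CS (memL (@cs_pred _) _ (valP x)))
    (fun y => @CSL R lam _ (memLinv (@cs_pred _) _ (valP y)))) => //.
- apply: (@Lambda_isometry R lam (cs0l lam) (cs0 R) \val \val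
    (fun x => CS0 (memL (@cs0_pred _) _ (valP x)))
    (fun y => @CS0L R lam _ (memLinv (@cs0_pred _) _ (valP y)))) => //.
- apply: (@Lambda_isometry R lam (bsl lam) (bs R) \val \val
    (fun x => BS (memL (@bs_pred _) _ (valP x)))
    (fun y => @BSL R lam _ (memLinv (@bs_pred _) _ (valP y)))) => //.
Qed.
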